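(* Let the GNR-surface $F_{(\alpha,q_n)}$ be developable. A unit speed surface curve $\vec\varphi(t)=\vec F_{(\alpha,q_n)}(s(t),u(t))$ (lying in the regular part of the surface), with $C=\dot s$ and $D=\dot u$, is a geodesic if and only if $$Cg\left(\dot D-C^2 g g_u\right)-D\left(C^2 g_s+2CD g_u+\dot C g\right)=0$$ along $\varphi$.
   Context: Let $I\subset\mathbb{R}$ be an open interval and $\alpha:I\to\mathbb{R}^3$ a smooth unit speed curve with arclength parameter $s$, positively oriented orthonormal Frenet frame $\{\vec T,\vec N,\vec B\}$, curvature $\kappa$ and torsion $\tau$: $\vec T=\vec\alpha'$, $\vec T'=\kappa\vec N$, $\vec N'=-\kappa\vec T+\tau\vec B$, $\vec B'=-\tau\vec N$ (prime is $d/ds$). Convention: either $\kappa>0$ on $I$, or $\alpha$ is a straight line, in which case $\kappa=\tau=0$ and $\vec N,\vec B$ are chosen constant. Let $a_1,a_2:I\to\mathbb{R}$ be smooth with $a_1^2+a_2^2=1$. The generalized normal ruled surface (GNR-surface) of $\alpha$ is $\vec F_{(\alpha,q_n)}(s,u)=\vec\alpha(s)+u\,\vec q_n(s)$, $(s,u)\in I\times\mathbb{R}$, with $\vec q_n=a_1\vec N+a_2\vec B$. It is developable if $\det(\vec\alpha',\vec q_n,\vec q_n')=0$ for all $s$. Put $g(s,u)=1-u\,a_1(s)\kappa(s)$, $g_s=\partial g/\partial s$, $g_u=\partial g/\partial u$. A dot denotes $d/dt$ along $\varphi$, so $\dot{\vec\varphi}=C\frac{\partial\vec F}{\partial s}+D\frac{\partial\vec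 F}{\partial u}=:\vec v_p$, which is a unit vector; $g,g_s,g_u$ are evaluated at $(s(t),u(t))$. The regular part is the set where $\frac{\partial\vec F}{\partial s}\times\frac{\partial\vec F}{\partial u}\neq0$. The curve $\varphi$ is a geodesic if its geodesic curvature $\kappa_g=\langle\vec v_p,\dot{\vec v}_p\times\vec U_\varphi\rangle$ vanishes identically, where $\vec U_\varphi=-a_2\vec N+a_1\vec B$ is the unit surface normal along $\varphi$. *)

(* Defs.v *)
From HB Require Import structures.
From mathcomp Require Import all_boot all_order all_algebra.
From mathcomp Require Import all_classical all_reals all_analysis.

Set Implicit Arguments.
Unset Strict Implicit.
Unset Printing Implicit Defensive.

Import Order.TTheory GRing.Theory Num.Theory.
Import numFieldNormedType.Exports.

Local Open Scope classical_set_scope.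
Local Open Scope ring_scope.

(* Vectors of R^3 are row vectors.  The canonical norm on 'rV[R]_3 is the sup
   norm, so Euclidean lengths are always expressed through dotv. *)

Section Euclidean3.
Context {R : realType}.
Implicit Types u v w : 'rV[R]_3.

Definition dotv u v : R := \sum_(k < 3) u 0 k * v 0 k.

(* Indices are added in 'I_3, i.e. modulo 3. *)
Definition crossv u v : 'rV[R]_3 :=
  \row_(k < 3) (u 0 (k + 1) * v 0 (k + 2%:R) - u 0 (k + 2%:R) * v 0 (k + 1)).

Definition det3 u v w : R := \det (\matrix_(i < 3) nth 0 [:: u; v; w] i).

End Euclidean3.

Section Curves.
Context {R : realType}.

Definition open_interval (I : set R) : Prop := open I /\ is_interval I.

(* Functions are total; only their values on I matter.  For open I this is
   the usual C^oo condition on I. *)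
Definition smooth_on {V : normedModType R} (I : set R) (f : R -> V) : Prop :=
  forall (n : nat) (x : R), I x -> derivable (derive1n n f) x 1.

(* Smoothness of N, B, kappa and tau is not assumed: it follows from that of
   alpha. *)
Record frenet_apparatus (I : set R) (alpha T N B : R -> 'rV[R]_3)
    (kappa tau : R -> R) : Prop := FrenetApparatus {
  frenet_smooth : smooth_on I alpha;
  frenet_unit : forall s, I s ->
    [/\ dotv (T s) (T s) = 1, dotv (N s) (N s) = 1 & dotv (B s) (B s) = 1];
  frenet_orthogonal : forall s, I s ->
    [/\ dotv (T s) (N s) = 0, dotv (T s) (B s) = 0 & dotv (N s) (B s) = 0];
  frenet_oriented : forall s, I s -> 0 < det3 (T s) (N s) (B s);
  frenet_alpha : forall s, I s -> is_derive s 1 alpha (T s);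
  frenet_T : forall s, I s -> is_derive s 1 T (kappa s *: N s);
  frenet_N : forall s, I s ->
    is_derive s 1 N (- kappa s *: T s + tau s *: B s);
  frenet_B : forall s, I s -> is_derive s 1 B (- tau s *: N s);
  frenet_curved_or_straight :
    (forall s, I s -> 0 < kappa s) \/
    [/\ exists p d : 'rV[R]_3, forall s, I s -> alpha s = p + s *: d,
        forall s, I s -> kappa s = 0 /\ tau s = 0,
        exists N0 : 'rV[R]_3, forall s, I s -> N s = N0 &
        exists B0 : 'rV[R]_3, forall s, I s -> B s = B0]
}.

End Curves.

Section Surfaces.
Context {R : realType}.

Definition partial_s {V : normedModType R} (f : R -> R -> V) (s u : R) : V :=
  derive1 (fun x => f x u) s.

Definition partial_u {V : normedModType R} (f : R -> R -> V) (s u : R) : V :=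
  derive1 (f s) u.

Definition gnr_director (a1 a2 : R -> R) (N B : R -> 'rV[R]_3) (s : R)
    : 'rV[R]_3 :=
  a1 s *: N s + a2 s *: B s.

Definition ruled_surface (alpha q : R -> 'rV[R]_3) (s u : R) : 'rV[R]_3 :=
  alpha s + u *: q s.

Definition developable_on (I : set R) (alpha q : R -> 'rV[R]_3) : Prop :=
  forall s, I s -> det3 (derive1 alpha s) (q s) (derive1 q s) = 0.

Definition regular_at (F : R -> R -> 'rV[R]_3) (s u : R) : Prop :=
  crossv (partial_s F s u) (partial_u F s u) != 0.

Definition gnr_normal (a1 a2 : R -> R) (N B : R -> 'rV[R]_3) (s : R)
    : 'rV[R]_3 :=
  - a2 s *: N s + a1 s *: B s.

Definition gnr_g (a1 kappa : R -> R) (s u : R) : R := 1 - u * a1 s * kappa s.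

(* U t is the unit normal of the surface at phi t. *)
Definition geodesic_curvature (phi U : R -> 'rV[R]_3) (t : R) : R :=
  dotv (derive1 phi t) (crossv (derive1n 2 phi t) (U t)).

Definition geodesic_on (J : set R) (phi U : R -> 'rV[R]_3) : Prop :=
  forall t, J t -> geodesic_curvature phi U t = 0.

Definition unit_speed_on (J : set R) (phi : R -> 'rV[R]_3) : Prop :=
  forall t, J t -> dotv (derive1 phi t) (derive1 phi t) = 1.

End Surfaces.

(* Main.v *)
Require Import Defs.
From HB Require Import structures.
From mathcomp Require Import all_boot all_order all_algebra.
From mathcomp Require Import all_classical all_reals all_analysis.
From mathcomp Require Import ring lra.

Set Implicit Arguments.
Unset Strict Implicit.
Unset Printing Implicit Defensive.

Import Order.TTheory GRing.Theory Num.Theory.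
Import numFieldNormedType.Exports.

Local Open Scope classical_set_scope.
Local Open Scope ring_scope.

(** Why the theorem holds.  Write [C], [D] for the derivatives of [s], [u].
    On a developable GNR-surface the director [q = a1 N + a2 B] satisfies
    [q' = - a1 kappa T] ([developable_director_is_derive]): the constraint
    [a1 ^+ 2 + a2 ^+ 2 = 1] and the developability condition kill the two
    other components of [q'].  Since [gu = - a1 kappa], this reads
    [q' = gu T], and [F_s = g T], [F_u = q].  The curve [phi] therefore has

      phi'  = C g T + D q,
      phi'' = ((C g)' + C D gu) T + D' q + C ^+ 2 g kappa N,

    with [(C g)' = C' g + C ^+ 2 gs + C D gu] ([surface_velocity],
    [surface_acceleration]).

    The geodesic curvature is the triple product of [phi'], [phi''] and
    [U = - a2 N + a1 B].  In the orthonormal frame [T], [q], [U] the vector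
    [N] has [q]-component [a1], so this triple product is

      C g (D' + C ^+ 2 g kappa a1) - D ((C g)' + C D gu),

    which is the left-hand side of the criterion because
    [kappa a1 = - gu] ([gnr_geodesic_curvatureE]).  The formula holds at each
    parameter separately, hence the equivalence.  The computation is carried
    out with coordinates relative to [T], [N], [B], leaving the determinant of
    that frame as a common factor; its positivity suffices to compare
    zeros. *)

(** * Triple products in a moving frame *)

Section FrameAlgebra.
Context {R : realType}.
Implicit Types u v w T N B : 'rV[R]_3.

Lemma sum_ord3 (F : 'I_3 -> R) : \sum_(k < 3) F k = F 0 + F 1 + F 2%:R.
Proof.
rewrite !big_ord_recl big_ord0 addr0 addrA.
by congr (F _ + F _ + F _); apply/val_inj.
Qed.

Lemma dotvZl c u v : dotv (c *: u) v = c * dotv u v.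
Proof. by rewrite /dotv mulr_sumr; apply: eq_bigr => k _; rewrite mxE mulrA. Qed.

Lemma dotv_crossvE u v w : dotv u (crossv v w) =
  u 0 0 * (v 0 1 * w 0 2%:R - v 0 2%:R * w 0 1) +
  u 0 1 * (v 0 2%:R * w 0 0 - v 0 0 * w 0 2%:R) +
  u 0 2%:R * (v 0 0 * w 0 1 - v 0 1 * w 0 0).
Proof.
rewrite /dotv sum_ord3 !mxE.
have [-> -> -> ->] : [/\ 0 + 1 = 1 :> 'I_3, 0 + 2%:R = 2%:R :> 'I_3,
  1 + 1 = 2%:R :> 'I_3 & 1 + 2%:R = 0 :> 'I_3] by split; apply/val_inj.
by have [-> ->] : 2%:R + 1 = 0 :> 'I_3 /\ 2%:R + 2%:R = 1 :> 'I_3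
  by split; apply/val_inj.
Qed.

Lemma det3E u v w : det3 u v w = dotv u (crossv v w).
Proof.
rewrite dotv_crossvE /det3 (expand_det_row _ 0) sum_ord3 /cofactor.
rewrite !(expand_det_row _ 0) !big_ord_recl !big_ord0 /cofactor !det_mx11 !mxE /=.
have -> : lift (0 : 'I_3) 0 = 1 by apply/val_inj.
have -> : lift (0 : 'I_3) (lift ord0 ord0) = 2%:R by apply/val_inj.
have -> : lift (1 : 'I_3) 0 = 0 by apply/val_inj.
have -> : lift (1 : 'I_3) (lift ord0 ord0) = 2%:R by apply/val_inj.
have -> : lift (2%:R : 'I_3) 0 = 0 by apply/val_inj.
have -> : lift (2%:R : 'I_3) (lift ord0 ord0) = 1 by apply/val_inj.
have -> : lift (lift ord0 ord0 : 'I_2) 0 = 0 by apply/val_inj.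
have [-> -> ->] : [/\ lift (0 : 'I_3) ord0 = 1, lift (1 : 'I_3) ord0 = 0
  & lift (2%:R : 'I_3) ord0 = 0] by split; apply/val_inj.
rewrite -[((1 %% 3 + 1 %% 3) %% 3)%N]/2%N -[(1 %% 3)%N]/1%N -[bump 0 0]/1%N.
ring.
Qed.

Lemma det3_director T N B (a1 a2 x y z : R) :
  det3 T (a1 *: N + a2 *: B) (x *: T + y *: N + z *: B) =
  (a1 * z - a2 * y) * det3 T N B.
Proof. by rewrite !det3E !dotv_crossvE !mxE; ring. Qed.

(** A curve on the surface has velocity in the plane of [T] and the director
    [q], while [N] is the only direction in which its acceleration may leave
    that plane; so its geodesic curvature is a determinant of this form. *)
Lemma det3_darboux T N B (a1 a2 p r x y z : R) :
  let q := a1 *: N + a2 *: B in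
  det3 (p *: T + r *: q) (x *: T + y *: q + z *: N) (- a2 *: N + a1 *: B) =
  ((p * y - r * x) * (a1 ^+ 2 + a2 ^+ 2) + p * z * a1) * det3 T N B.
Proof. by rewrite /= !det3E !dotv_crossvE !mxE; ring. Qed.

End FrameAlgebra.

(** * Derivatives of vector functions *)

Section VectorCalculus.
Context {R : realType}.

Lemma smooth_on_is_derive (V : normedModType R) (I : set R) (f : R -> V) n x :
  smooth_on I f -> I x -> is_derive x 1 (derive1n n f) (derive1n n.+1 f x).
Proof. by move=> sf Ix; rewrite derive1nS derive1E; apply/derivableP/sf. Qed.

Lemma is_derive_rowP n (f : R -> 'rV[R]_n) (x : R) df :
  is_derive x 1 f df <-> forall k, is_derive x 1 (fun y => f y 0 k) (df 0 k).
Proof.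
split=> [[fx <-] k|fx].
  have /derivable_mxP/(_ 0 k) fk := fx.
  by apply: DeriveDef => //; rewrite derive_mx// mxE.
have dfx : derivable f x 1.
  by apply/derivable_mxP => i k; rewrite ord1; case: (fx k).
apply: DeriveDef => //; rewrite derive_mx//.
by apply/rowP => k; rewrite mxE; case: (fx k).
Qed.

Lemma is_derive_scalev n (c : R -> R) (f : R -> 'rV[R]_n) (x : R) dc df :
  is_derive x 1 c dc -> is_derive x 1 f df ->
  is_derive x 1 (fun y => c y *: f y) (dc *: f x + c x *: df).
Proof.
move=> cx /is_derive_rowP fx; apply/is_derive_rowP => k.
have := is_deriveM cx (fx k).
rewrite [X in is_derive _ _ X](_ : _ = fun y => (c y *: f y) 0 k); last first.
  by apply/funext => y; rewrite mxE.
by move/is_derive_eq; apply; rewrite !mxE /GRing.scale /=; ring.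
Qed.

Lemma is_derive_compv n (f : R -> 'rV[R]_n) (s : R -> R) (x : R) df ds :
  is_derive (s x) 1 f df -> is_derive x 1 s ds ->
  is_derive x 1 (fun y => f (s y)) (ds *: df).
Proof.
move=> /is_derive_rowP fx sx; apply/is_derive_rowP => k.
by have := is_derive1_comp (fx k) sx; rewrite mxE mulrC.
Qed.

Lemma derivable_dotv (f g : R -> 'rV[R]_3) (x : R) :
  derivable f x 1 -> derivable g x 1 ->
  derivable (fun y => dotv (f y) (g y)) x 1.
Proof.
move=> /derivable_mxP fx /derivable_mxP gx; rewrite /dotv.
rewrite (_ : (fun _ => _) = \sum_(k < 3) ((fun y => f y 0 k) * (fun y => g y 0 k))).
  by apply: derivable_sum => k; apply: derivableM.
by apply/funext => y; rewrite fct_sumE.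
Qed.

End VectorCalculus.

(** * The generalized normal ruled surface and its curves *)

Section GNRSurface.
Context {R : realType}.
Variables (I : set R) (alpha T N B : R -> 'rV[R]_3) (kappa tau a1 a2 : R -> R).
Hypothesis openI : open I.
Hypothesis frenetI : frenet_apparatus I alpha T N B kappa tau.

Let nearI x : I x -> \forall y \near x, I y.
Proof. by move=> Ix; apply: open_nbhs_nbhs. Qed.

(** Differentiability of the curvature is what makes [gnr_g a1 kappa]
    differentiable along a curve on the surface.  It is inherited from
    [alpha]: on [I] the second derivative of [alpha] is [kappa *: N], so
    [kappa] is the inner product of two differentiable vector functions. *)
Lemma curvature_derivable x : I x -> derivable kappa x 1.
Proof.
move=> Ix.
have d2 y : I y -> derive1n 2 alpha y = kappa y *: N y.
  move=> Iy; rewrite derive1nS derive1n1 derive1E.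
  rewrite (@near_eq_derive _ _ _ _ T); first by case: (frenet_T frenetI Iy).
  near=> z; rewrite derive1E; have Iz : I z by near: z; exact: nearI.
  by case: (frenet_alpha frenetI Iz).
have kE : {near x, (fun y => dotv (derive1n 2 alpha y) (N y)) =1 kappa}.
  near=> y; have Iy : I y by near: y; exact: nearI.
  by rewrite d2// dotvZl; have [_ -> _] := frenet_unit frenetI Iy; rewrite mulr1.
apply: (near_eq_derivable kE); apply: derivable_dotv.
  by case: (smooth_on_is_derive 2 (frenet_smooth frenetI) Ix).
by case: (frenet_N frenetI Ix).
Unshelve. all: by end_near. Qed.

Hypothesis smooth_a1 : smooth_on I a1.
Hypothesis smooth_a2 : smooth_on I a2.
Hypothesis a_unit : forall x, I x -> a1 x ^+ 2 + a2 x ^+ 2 = 1.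

Let q := gnr_director a1 a2 N B.

Lemma gnr_director_is_derive x : I x ->
  is_derive x 1 q (- (a1 x * kappa x) *: T x
    + (derive1 a1 x - a2 x * tau x) *: N x
    + (derive1 a2 x + a1 x * tau x) *: B x).
Proof.
move=> Ix.
have da1 : is_derive x 1 a1 (derive1 a1 x).
  exact: (smooth_on_is_derive 0 smooth_a1 Ix).
have da2 : is_derive x 1 a2 (derive1 a2 x).
  exact: (smooth_on_is_derive 0 smooth_a2 Ix).
have := is_deriveD (is_derive_scalev da1 (frenet_N frenetI Ix))
                   (is_derive_scalev da2 (frenet_B frenetI Ix)).
by move/is_derive_eq; apply; apply/rowP => k; rewrite !mxE; ring.
Qed.

Hypothesis dev : developable_on I alpha q.

(** On a developable GNR-surface the director moves parallel to [T].  The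
    components of [q'] on [N] and [B] form a plane vector: it is orthogonal to
    [(a1, a2)] because [a1 ^+ 2 + a2 ^+ 2] is constant, and parallel to
    [(a1, a2)] because the surface is developable.  Hence it vanishes, which
    amounts to [tau = a2 * a1' - a1 * a2']. *)
Lemma developable_director_is_derive x : I x ->
  is_derive x 1 q (- (a1 x * kappa x) *: T x).
Proof.
move=> Ix; have dq := gnr_director_is_derive Ix.
have da1 := smooth_on_is_derive 0 smooth_a1 Ix.
have da2 := smooth_on_is_derive 0 smooth_a2 Ix.
have sphere : a1 x * derive1 a1 x + a2 x * derive1 a2 x = 0.
  have const : \forall y \near x, (a1 * a1 + a2 * a2) y = cst 1 y.
    near=> y; have Iy : I y by near: y; exact: nearI.
    by rewrite /= -(a_unit Iy).
  have [_] := near_eq_is_derive const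
    (is_deriveD (is_deriveM da1 da1) (is_deriveM da2 da2)).
  rewrite derive_cst /GRing.scale /=.
  by move: (a1 x) (a2 x) (derive1 a1 x) (derive1 a2 x) => *; lra.
have twist : a1 x * (derive1 a2 x + a1 x * tau x)
    - a2 x * (derive1 a1 x - a2 x * tau x) = 0.
  have := dev Ix; rewrite !derive1E.
  have [_ ->] := frenet_alpha frenetI Ix; have [_ ->] := dq.
  rewrite det3_director -!derive1E => /eqP.
  by rewrite mulf_eq0 (gt_eqF (frenet_oriented frenetI Ix)) orbF => /eqP.
have unitx := a_unit Ix.
(* The unit pair [(a1, a2)] inverts the linear system [sphere], [twist]. *)
have N0 : derive1 a1 x - a2 x * tau x = 0.
  transitivity ((a1 x ^+ 2 + a2 x ^+ 2) * (derive1 a1 x - a2 x * tau x)).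
    by rewrite unitx mul1r.
  transitivity (a1 x * (a1 x * derive1 a1 x + a2 x * derive1 a2 x)
    - a2 x * (a1 x * (derive1 a2 x + a1 x * tau x)
    - a2 x * (derive1 a1 x - a2 x * tau x))); first by ring.
  by rewrite sphere twist; ring.
have B0 : derive1 a2 x + a1 x * tau x = 0.
  transitivity ((a1 x ^+ 2 + a2 x ^+ 2) * (derive1 a2 x + a1 x * tau x)).
    by rewrite unitx mul1r.
  transitivity (a2 x * (a1 x * derive1 a1 x + a2 x * derive1 a2 x)
    + a1 x * (a1 x * (derive1 a2 x + a1 x * tau x)
    - a2 x * (derive1 a1 x - a2 x * tau x))); first by ring.
  by rewrite sphere twist; ring.
by move: dq; rewrite N0 B0 !scale0r !addr0.
Unshelve. all: by end_near. Qed.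

Variables (J : set R) (s u : R -> R).
Hypothesis openJ : open J.
Hypothesis smooth_s : smooth_on J s.
Hypothesis smooth_u : smooth_on J u.
Hypothesis sJI : forall t, J t -> I (s t).

Let F := ruled_surface alpha q.
Let phi := fun t => F (s t) (u t).
Let C : R -> R := derive1 s.
Let D : R -> R := derive1 u.
Let g := fun t => gnr_g a1 kappa (s t) (u t).
Let gs : R -> R := fun t => partial_s (gnr_g a1 kappa) (s t) (u t).
Let gu : R -> R := fun t => partial_u (gnr_g a1 kappa) (s t) (u t).

Let s_is_derive t : J t -> is_derive t 1 s (C t).
Proof. by move=> Jt; exact: (smooth_on_is_derive 0 smooth_s Jt). Qed.

Let u_is_derive t : J t -> is_derive t 1 u (D t).
Proof. by move=> Jt; exact: (smooth_on_is_derive 0 smooth_u Jt). Qed.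

(** Since [q'] is parallel to [T], the surface has [F_s = g *: T]; no other
    component of the frame enters the velocity. *)
Lemma surface_velocity t : J t ->
  is_derive t 1 phi (C t * g t *: T (s t) + D t *: q (s t)).
Proof.
move=> Jt; have Is := sJI Jt; have ds := s_is_derive Jt.
have dalpha := is_derive_compv (frenet_alpha frenetI Is) ds.
have dq := is_derive_compv (developable_director_is_derive Is) ds.
have := is_deriveD dalpha (is_derive_scalev (u_is_derive Jt) dq).
move/is_derive_eq; apply; apply/rowP => k.
by rewrite /g /gnr_g !mxE; ring.
Qed.

Lemma gnr_g_partial_u t : gu t = - (a1 (s t) * kappa (s t)).
Proof.
set c := a1 (s t) * kappa (s t).
have gE : gnr_g a1 kappa (s t) = cst 1 - id * cst c.
  by apply/funext => y; rewrite /gnr_g -mulrA.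
rewrite /gu /partial_u derive1E gE.
have [_ ->] := is_deriveB (is_derive_cst (1 : R) (u t) 1)
  (is_deriveM (is_derive_id (u t) 1) (is_derive_cst c (u t) 1)).
by rewrite /GRing.scale /=; ring.
Qed.

Lemma gnr_g_is_derive t : J t -> is_derive t 1 g (C t * gs t + D t * gu t).
Proof.
move=> Jt; have Is := sJI Jt; have ds := s_is_derive Jt; set h := a1 * kappa.
have dh : is_derive (s t) 1 h (derive1 h (s t)).
  rewrite derive1E; apply/derivableP/derivableM; last exact: curvature_derivable.
  by case: (smooth_on_is_derive 0 smooth_a1 Is).
have gsE : gs t = - (u t * derive1 h (s t)).
  have gE : (fun x => gnr_g a1 kappa x (u t)) = cst 1 - u t \*: h.
    by apply/funext => y; rewrite /gnr_g -mulrA.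
  rewrite /gs /partial_s derive1E gE.
  have [_ ->] := is_deriveB (is_derive_cst (1 : R) (s t) 1) (is_deriveZ (u t) dh).
  by rewrite sub0r.
have gE : g = cst 1 - u * (h \o s).
  by apply/funext => y; rewrite /g /gnr_g -mulrA.
have := is_deriveB (is_derive_cst (1 : R) t 1)
  (is_deriveM (u_is_derive Jt) (is_derive1_comp dh ds)).
rewrite -gE; move/is_derive_eq; apply.
by rewrite gsE gnr_g_partial_u -[a1 (s t) * _]/(h (s t)) /GRing.scale /=; ring.
Qed.

(** The term [2 * C * D * gu] on [T] has two equal sources: the derivative of
    [g] along the curve, and [q' = gu *: T]. *)
Lemma surface_acceleration t : J t ->
  derive1n 2 phi t =
  (derive1 C t * g t + C t * (C t * gs t + 2%:R * D t * gu t)) *: T (s t)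
  + derive1 D t *: q (s t) + (C t ^+ 2 * g t * kappa (s t)) *: N (s t).
Proof.
move=> Jt; have Is := sJI Jt; have ds := s_is_derive Jt.
have dC : is_derive t 1 C (derive1 C t).
  exact: (smooth_on_is_derive 1 smooth_s Jt).
have dD : is_derive t 1 D (derive1 D t).
  exact: (smooth_on_is_derive 1 smooth_u Jt).
have dT := is_derive_compv (frenet_T frenetI Is) ds.
have dq := is_derive_compv (developable_director_is_derive Is) ds.
have velE : \forall z \near t,
    ((fun z => (C * g) z *: T (s z)) + (fun z => D z *: q (s z))) z
      = derive1 phi z.
  near=> z; have Jz : J z by near: z; exact: open_nbhs_nbhs.
  by rewrite derive1E; have [_ ->] := surface_velocity Jz.
have [_] := near_eq_is_derive velE (is_deriveD
  (is_derive_scalev (is_deriveM dC (gnr_g_is_derive Jt)) dT)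
  (is_derive_scalev dD dq)).
rewrite -derive1E -[derive1n 2 phi]/(derive1 (derive1 phi)) => ->.
apply/rowP => k; rewrite gnr_g_partial_u -[(C * g) t]/(C t * g t) !mxE.
rewrite /GRing.scale /=.
move: (C t) (D t) (g t) (gs t) (derive1 C t) (derive1 D t) => *; ring.
Unshelve. all: by end_near. Qed.

(** The criterion is the vanishing of a quantity that is, up to the positive
    volume of the frame, the geodesic curvature itself. *)
Lemma gnr_geodesic_curvatureE t : J t ->
  geodesic_curvature phi (fun t => gnr_normal a1 a2 N B (s t)) t =
  (C t * g t * (derive1 D t - C t ^+ 2 * g t * gu t)
   - D t * (C t ^+ 2 * gs t + 2%:R * C t * D t * gu t + derive1 C t * g t))
  * det3 (T (s t)) (N (s t)) (B (s t)).
Proof.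
move=> Jt; rewrite /geodesic_curvature surface_acceleration// derive1E.
have [_ ->] := surface_velocity Jt.
rewrite -det3E det3_darboux a_unit; last exact: sJI.
rewrite gnr_g_partial_u.
by move: (C t) (D t) (g t) (gs t) (derive1 C t) (derive1 D t) => *; ring.
Qed.

End GNRSurface.

Theorem corollary3p19 (R : realType) (I : set R)
    (alpha T N B : R -> 'rV[R]_3) (kappa tau a1 a2 : R -> R)
    (J : set R) (s u : R -> R) :
  open_interval I ->
  frenet_apparatus I alpha T N B kappa tau ->
  smooth_on I a1 -> smooth_on I a2 ->
  (forall x, I x -> a1 x ^+ 2 + a2 x ^+ 2 = 1) ->
  let q := gnr_director a1 a2 N B in
  let F := ruled_surface alpha q in
  developable_on I alpha q ->
  open_interval J ->
  smooth_on J s -> smooth_on J u ->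
  (forall t, J t -> I (s t)) ->
  (forall t, J t -> regular_at F (s t) (u t)) ->
  let phi := fun t => F (s t) (u t) in
  unit_speed_on J phi ->
  let U := fun t => gnr_normal a1 a2 N B (s t) in
  let C := derive1 s in
  let D := derive1 u in
  let g := fun t => gnr_g a1 kappa (s t) (u t) in
  let gs := fun t => partial_s (gnr_g a1 kappa) (s t) (u t) in
  let gu := fun t => partial_u (gnr_g a1 kappa) (s t) (u t) in
  geodesic_on J phi U <->
  (forall t, J t ->
     C t * g t * (derive1 D t - C t ^+ 2 * g t * gu t)
     - D t * (C t ^+ 2 * gs t + 2%:R * C t * D t * gu t + derive1 C t * g t) = 0).
Proof.
move=> [openI _] fr sa1 sa2 unit_a q F dev [openJ _] ss su sJI _ phi _ U C D g gs gu.
have kgE := gnr_geodesic_curvatureE openI fr sa1 sa2 unit_a dev openJ ss su sJI.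
have det_gt0 t : J t -> 0 < det3 (T (s t)) (N (s t)) (B (s t)).
  by move=> Jt; exact/(frenet_oriented fr)/sJI.
split=> [geo t Jt|eq0 t Jt].
  have := geo t Jt; rewrite kgE// => /eqP.
  by rewrite mulf_eq0 (gt_eqF (det_gt0 t Jt)) orbF => /eqP.
by rewrite kgE// eq0// mul0r.
Qed.
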